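(* For every $c>1$ there exists a continuous function $f:[0,1]\to\mathbb{R}$ whose graph $\{(x,f(x)):x\in[0,1]\}\subseteq\mathbb{R}^2$ is symmetrically $c$-monotone, and such that the set of points $x\in[0,1]$ at which $f$ has a derivative (finite or infinite) has Lebesgue measure zero.
   Context: A metric space $(X,d)$ is symmetrically $c$-monotone if there is a linear order $<$ on $X$ such that $\max(d(x,y),d(y,z))\le c\,d(x,z)$ whenever $x<y<z$ in $X$. The graph is a subset of $\mathbb{R}^2$ with the Euclidean metric. *)

(* Defs.v *)
From HB Require Import structures.
From mathcomp Require Import all_boot all_order all_algebra.
From mathcomp Require Import all_classical all_reals all_analysis.
Set Implicit Arguments. Unset Strict Implicit. Unset Printing Implicit Defensive.
Import Order.TTheory GRing.Theory Num.Theory.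
Import numFieldNormedType.Exports.
Local Open Scope classical_set_scope.
Local Open Scope ring_scope.

Definition eucl_dist {R : realType} (p q : R * R) : R :=
  Num.sqrt ((p.1 - q.1) ^+ 2 + (p.2 - q.2) ^+ 2).

Definition strict_linear_order_on {T : Type} (X : set T) (lt : T -> T -> Prop) :=
  [/\ (forall x, X x -> ~ lt x x),
      (forall x y z, X x -> X y -> X z -> lt x y -> lt y z -> lt x z) &
      (forall x y, X x -> X y -> x <> y -> lt x y \/ lt y x)].

Definition sym_c_monotone {R : realType} (c : R) (X : set (R * R)) : Prop :=
  exists lt : R * R -> R * R -> Prop,
    strict_linear_order_on X lt /\
    forall x y z, X x -> X y -> X z -> lt x y -> lt y z ->
      Num.max (eucl_dist x y) (eucl_dist y z) <= c * eucl_dist x z.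

Definition unit_interval {R : realType} : set R := [set x | 0 <= x <= 1].

Definition graph01 {R : realType} (f : R -> R) : set (R * R) :=
  [set p | unit_interval p.1 /\ p.2 = f p.1].

(* f (considered on [0,1]) has a derivative, finite or infinite, at x:
   the difference quotient converges in the extended reals as y -> x,
   y in [0,1], y <> x (one-sided at the endpoints). *)
Definition has_ext_derivative {R : realType} (f : R -> R) (x : R) : Prop :=
  exists l : \bar R,
    ((fun y => ((f y - f x) / (y - x))%:E) @ within unit_interval (x^'))
      --> l.

Definition ext_diff_points {R : realType} (f : R -> R) : set R :=
  [set x | unit_interval x /\ has_ext_derivative f x].

(* Main.v *)
Require Import Defs.
From HB Require Import structures.
From mathcomp Require Import all_boot all_order all_algebra.
From mathcomp Require Import all_classical all_reals all_analysis.
From mathcomp Require Import zify ring lra.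
Import Order.TTheory GRing.Theory Num.Theory.
Import numFieldNormedType.Exports.
Local Open Scope classical_set_scope.
Local Open Scope ring_scope.

(** The function is a uniform limit of piecewise affine functions [f_n]. To pass
from [f_n] to [f_(n+1)], every affine piece, of slope [s] say, is replaced by a
fine staircase with slope [t] except on a set of small proportion, where it is
steep; [t] alternates between [0] and [eps]. On a single piece, [f_(n+1) - t * id]
is monotone, so that its graph is symmetrically [(1 + eps)^2]-monotone. Moreover
[f_(n+1) - f_n] is at most a tiny multiple of the distance to the break points of
[f_n]: hence for [x] and [z] in different pieces it is at most a tiny multiple of
[z - x] on [[x, z]], and the monotonicity constant of [f_n] hardly changes. By
Borel-Cantelli, almost every [x] has, for all large [n], a nearby [y_n] such that
the difference quotient between [x] and [y_n] is close to [0] for even [n] and to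
[eps] for odd [n]. *)

Section OscillatingGraphs.
Set Implicit Arguments.
Unset Strict Implicit.
Context {R : realType}.
Implicit Types (a b m x y z t s d k l v : R) (f g : R -> R).

(** * Piecewise affine functions, one-sided turning and prescribed slopes *)

(** Consecutive closed pieces share their end point, so continuity is built in. Induction on the
    derivation replaces induction on a list of break points. *)
Inductive piecewise_affine f : R -> R -> Prop :=
| Affine_piece a b k s of (forall x, a <= x <= b -> f x = k + s * x) :
    piecewise_affine f a b
| Concat_pieces m a b of a < m < b & piecewise_affine f a m
    & piecewise_affine f m b : piecewise_affine f a b.

Lemma eq_piecewise_affine f g a b : (forall x, a <= x <= b -> f x = g x) ->
  piecewise_affine f a b -> piecewise_affine g a b.
Proof.
move=> + paf; elim: paf g => {a b} [a b k s fE|m a b ambH _ IH1 _ IH2] g fg.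
  by apply: (@Affine_piece _ _ _ k s) => x xab; rewrite -fg// fE.
have /andP[am mb] := ambH.
apply: (@Concat_pieces _ m) => //.
  by apply: IH1 => x /andP[ax xm]; apply: fg; apply/andP; split; lra.
by apply: IH2 => x /andP[ax xm]; apply: fg; apply/andP; split; lra.
Qed.

Lemma piecewise_affine_lipschitz f a b : piecewise_affine f a b ->
  exists2 k, 0 < k & forall x y, a <= x <= y -> y <= b ->
    `|f y - f x| <= k * (y - x).
Proof.
elim=> {a b} [a b k s fE|m a b /andP[am mb] _ [k1 k10 H1] _ [k2 k20 H2]].
  exists (`|s| + 1); first by rewrite ltr_wpDl.
  move=> x y /andP[ax xy] yb; rewrite !fE; [|apply/andP; split; lra..].
  have -> : k + s * y - (k + s * x) = s * (y - x) by ring.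
  by rewrite normrM (@ger0_norm _ (y - x)) ?subr_ge0// ler_wpM2r ?subr_ge0 ?lerDl.
exists (k1 + k2); first by lra.
move=> x y /andP[ax xy] yb.
have [ym|my] := leP y m.
  have := H1 x y; rewrite ax xy => /(_ isT ym) /le_trans; apply.
  by rewrite ler_wpM2r ?subr_ge0//; lra.
have [mx|xm] := leP m x.
  have := H2 x y; rewrite mx xy => /(_ isT yb) /le_trans; apply.
  by rewrite ler_wpM2r ?subr_ge0//; lra.
have h1 : `|f m - f x| <= k1 * (m - x) by apply: H1 => //; rewrite ax ltW.
have h2 : `|f y - f m| <= k2 * (y - m) by apply: H2 => //; rewrite lexx ltW.
have -> : f y - f x = (f m - f x) + (f y - f m) by ring.
apply: le_trans (ler_normD _ _) _; nra.
Qed.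

(* [sg] is meant to be [1] or [-1]: relative to the direction of slope [t],
   the graph of [g] only turns to one side. *)
Definition sheared_monotone sg t g a b :=
  forall x y, a <= x -> x <= y -> y <= b ->
  0 <= sg * (g y - g x - t * (y - x)).

Lemma sheared_monotone_cat sg t g m a b : a <= m <= b ->
  sheared_monotone sg t g a m -> sheared_monotone sg t g m b ->
  sheared_monotone sg t g a b.
Proof.
move=> /andP[am mb] H1 H2 x y ax xy yb.
have [ym|my] := leP y m; first exact: H1.
have [mx|xm] := leP m x; first exact: H2.
have := H1 x m ax (ltW xm) (lexx _); have := H2 m y (lexx _) (ltW my) yb.
nra.
Qed.

Lemma eq_sheared_monotone sg t f g a b : (forall x, a <= x <= b -> f x = g x) ->
  sheared_monotone sg t f a b -> sheared_monotone sg t g a b.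
Proof.
by move=> fg H x y ax xy yb; rewrite -!fg ?H//; apply/andP; split; lra.
Qed.

(* The lower bound [e] on [|y - x|] makes the slope survive perturbations of
   size much smaller than [e]. *)
Definition mostly_slope t l v g a b := exists2 e, 0 < e &
  exists B : set R, [/\ measurable B, (lebesgue_measure B <= v%:E)%E &
    forall x, a <= x <= b -> ~ B x ->
      exists y, [/\ a <= y <= b, e <= `|y - x| <= l & g y - g x = t * (y - x)]].

Lemma mostly_slope_cat t l v1 v2 g m a b : a <= m <= b ->
  mostly_slope t l v1 g a m -> mostly_slope t l v2 g m b ->
  mostly_slope t l (v1 + v2) g a b.
Proof.
move=> /andP[am mb] [e1 e10 [B1 [mB1 B1v H1]]] [e2 e20 [B2 [mB2 B2v H2]]].
exists (Num.min e1 e2); first by rewrite lt_min e10.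
exists (B1 `|` B2); split; first exact: measurableU.
  rewrite EFinD; have U := measureU2 (@lebesgue_measure R) mB1 mB2.
  by apply: le_trans U _; exact: leeD.
move=> x /andP[ax xb] /not_orP[nB1 nB2].
have [xm|/ltW mx] := leP x m.
- have [|y [/andP[ay ym] /andP[ey yl] yE]] := H1 x _ nB1; first by rewrite ax.
  exists y; split; rewrite ?yl ?andbT ?ge_min ?ey//; apply/andP; split; lra.
- have [|y [/andP[ay ym] /andP[ey yl] yE]] := H2 x _ nB2; first by rewrite mx.
  exists y; split; rewrite ?yl ?andbT ?ge_min ?ey ?orbT//; apply/andP; split; lra.
Qed.

Lemma mostly_slopeW t l l' v v' f g a b : (forall x, a <= x <= b -> f x = g x) ->
  l <= l' -> v <= v' -> mostly_slope t l v f a b -> mostly_slope t l' v' g a b.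
Proof.
move=> fg ll vv [e e0 [B [mB Bv H]]]; exists e => //; exists B; split => //.
  by apply: le_trans Bv _; rewrite lee_fin.
move=> x xab /(H _ xab)[y [yab /andP[ey yl] yE]].
by exists y; split; rewrite ?ey ?(le_trans yl)// -!fg.
Qed.

Lemma lebesgue_measure_cc a b : a <= b ->
  lebesgue_measure [set` `[a, b]] = (b - a)%:E.
Proof.
rewrite lebesgue_measure_itv/= lte_fin le_eqVlt => /orP[/eqP ->|->].
  by rewrite ltxx subrr.
by rewrite EFinB.
Qed.

(** The whole interval is declared exceptional; this serves for the short end intervals on which a
    refinement leaves the function unchanged. *)
Lemma mostly_slope_trivial t l g a b : a <= b -> mostly_slope t l (b - a) g a b.
Proof.
move=> ab; exists 1 => //; exists [set` `[a, b]]; split => //.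
by rewrite lebesgue_measure_cc.
Qed.

(** * Staircases over one affine piece *)

(** One stair: slope [t] on [[u, w]], then a steep part of proportion [p] that brings [g] back to
    the affine function at [v]. Up to a constant, [g - t * id] is [(s - t) * r] with [r]
    nondecreasing, hence monotone. *)
Lemma stair_cell sg t k s p u v : 0 <= sg * (s - t) -> 0 < p < 1 -> u < v ->
  exists g, [/\ piecewise_affine g u v,
    g u = k + s * u /\ g v = k + s * v,
    forall x, u <= x <= v -> `|g x - (k + s * x)| <= `|s - t| * (v - u),
    mostly_slope t (v - u) (p * (v - u)) g u v & sheared_monotone sg t g u v].
Proof.
move=> sgst /andP[p0 p1] uv; pose w := v - p * (v - u).
have [uw wv] : u < w /\ w < v by rewrite /w; split; nra.
pose r x := Num.max 0 (x - w) / p.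
have rl x : x <= w -> r x = 0 by move=> xw; rewrite /r max_l ?mul0r// subr_le0.
have rr x : w <= x -> r x = (x - w) / p by move=> xw; rewrite /r max_r// subr_ge0.
have rnd x y : x <= y -> r x <= r y.
  by move=> xy; rewrite /r ler_pM2r ?invr_gt0// ge_max !le_max lexx /= lerB ?orbT.
have rv : r v = v - u by rewrite rr ?ltW// /w; field; rewrite gt_eqF.
have r_ge0 x : 0 <= r x by rewrite /r divr_ge0 ?le_max ?lexx// ltW.
pose g x := k + s * u + t * (x - u) + (s - t) * r x.
exists g; split.
- apply: (@Concat_pieces _ w); first by rewrite uw wv.
    apply: (@Affine_piece _ _ _ (k + s * u - t * u) t) => x /andP[_ xw].
    by rewrite /g rl//; ring.
  apply: (@Affine_piece _ _ _ (k + s * u - t * u - (s - t) * (w / p)) (t + (s - t) / p)).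
  by move=> x /andP[wx _]; rewrite /g rr//; ring.
- by rewrite /g rv rl ?(ltW uw)//; split; ring.
- move=> x /andP[ux xv].
  (* Both [r x] and [x - u] lie between [0] and [v - u]. *)
  have -> : g x - (k + s * x) = (s - t) * (r x - (x - u)) by rewrite /g; ring.
  rewrite normrM ler_wpM2l// ler_norml.
  by have := rnd _ _ xv; rewrite rv; have := r_ge0 x => *; apply/andP; split; lra.
(* One of the two ends [u], [w] of the flat part is at least half its length away from [x]. *)
- exists ((w - u) / 2); first by lra.
  exists [set` `[w, v]]; split => //.
    by rewrite (lebesgue_measure_cc (ltW wv)) lee_fin /w; lra.
  move=> x /andP[ux xv] nB.
  have xw : x < w.
    by rewrite ltNge; apply/negP => wx; apply: nB; rewrite /= in_itv/= wx xv.
  have [h|h] := leP (x - u) ((w - u) / 2).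
    exists w; split; first (apply/andP; split; lra).
      rewrite ger0_norm; last lra.
      by apply/andP; split; lra.
    by rewrite /g (rl w)// (rl x (ltW xw)); ring.
  exists u; split; first (apply/andP; split; lra).
    rewrite ler0_norm; last lra.
    by apply/andP; split; lra.
  by rewrite /g (rl u (ltW uw)) (rl x (ltW xw)); ring.
- move=> x y _ xy _.
  have -> : sg * (g y - g x - t * (y - x)) = (sg * (s - t)) * (r y - r x).
    by rewrite /g; ring.
  by rewrite mulr_ge0// subr_ge0 rnd.
Qed.

Definition glue m f g x := if x <= m then f x else g x.

Lemma glue_l m f g x : x <= m -> f x = glue m f g x.
Proof. by rewrite /glue => ->. Qed.

Lemma glue_r m f g x : f m = g m -> m <= x -> g x = glue m f g x.
Proof.
by rewrite /glue => fg; rewrite le_eqVlt => /orP[/eqP <-|/lt_geF ->//]; rewrite lexx.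
Qed.

(** Bisecting [n] times and putting one stair on each interval divides the error and the step length
    by [2 ^ n], while the exceptional measures still add up to [p * (v - u)]. *)
Lemma staircase sg t k s p n u v : 0 <= sg * (s - t) -> 0 < p < 1 -> u < v ->
  exists g, [/\ piecewise_affine g u v,
    g u = k + s * u /\ g v = k + s * v,
    forall x, u <= x <= v -> `|g x - (k + s * x)| <= `|s - t| * ((v - u) / 2 ^+ n),
    mostly_slope t ((v - u) / 2 ^+ n) (p * (v - u)) g u v &
    sheared_monotone sg t g u v].
Proof.
move=> sgst p01; elim: n u v => [|n IH] u v uv.
  by rewrite expr0 divr1; exact: stair_cell.
pose m := (u + v) / 2.
have [um mv] : u < m /\ m < v by rewrite /m; split; lra.
have [g1 [pa1 [g1u g1m] b1 ms1 sm1]] := IH _ _ um.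
have [g2 [pa2 [g2m g2v] b2 ms2 sm2]] := IH _ _ mv.
have g12 : g1 m = g2 m by rewrite g1m g2m.
have E1 x : u <= x <= m -> g1 x = glue m g1 g2 x by move=> /andP[_ ?]; exact: glue_l.
have E2 x : m <= x <= v -> g2 x = glue m g1 g2 x by move=> /andP[? _]; exact: glue_r.
have lE : (v - u) / 2 ^+ n.+1 = (m - u) / 2 ^+ n.
  by rewrite /m exprS; field; rewrite expf_neq0.
have lE' : (v - u) / 2 ^+ n.+1 = (v - m) / 2 ^+ n.
  by rewrite /m exprS; field; rewrite expf_neq0.
have umv : u <= m <= v by rewrite !ltW.
exists (glue m g1 g2); split.
- apply: (@Concat_pieces _ m); first by rewrite um mv.
    exact: eq_piecewise_affine pa1.
  exact: eq_piecewise_affine pa2.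
- by rewrite -E1 ?lexx ?ltW// -E2 ?lexx ?ltW.
- move=> x /andP[ux xv]; have [xm|/ltW mx] := leP x m.
    by rewrite -E1 ?ux// lE; apply: b1; rewrite ux.
  by rewrite -E2 ?mx// lE'; apply: b2; rewrite mx.
- have -> : p * (v - u) = p * (m - u) + p * (v - m) by ring.
  apply: (mostly_slope_cat umv).
    by apply: (mostly_slopeW E1 _ _ ms1); rewrite ?lE.
  by apply: (mostly_slopeW E2 _ _ ms2); rewrite ?lE'.
- apply: (sheared_monotone_cat umv); first exact: eq_sheared_monotone sm1.
  exact: eq_sheared_monotone sm2.
Qed.

Lemma exists_div_exp2_le (x e : R) : 0 <= x -> 0 < e -> exists n, x / 2 ^+ n <= e.
Proof.
move=> x0 e0; exists (Num.bound (x / e)).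
have := archi_boundP (divr_ge0 x0 (ltW e0)); set n := Num.bound _ => h.
rewrite ler_pdivrMr ?exprn_gt0// mulrC -ler_pdivrMr// (le_trans (ltW h))//.
by rewrite -natrX ler_nat ltnW// ltn_expl.
Qed.

(** * Refinement of a piecewise affine function *)

(** The error vanishes at both ends, so refinements of adjacent pieces can be glued. In the third
    clause, the first alternative is meant for [x] and [z] in one affine piece of [f], the second
    for a break point between them. *)
Definition refines t d l v f g a b :=
  [/\ piecewise_affine g a b,
      forall x, a <= x <= b ->
        `|g x - f x| <= d * (x - a) /\ `|g x - f x| <= d * (b - x),
      forall x z, a <= x -> x <= z -> z <= b ->
        (exists2 sg, `|sg| = 1 & sheared_monotone sg t g x z) \/
        (forall y, x <= y <= z -> `|g y - f y| <= d * (z - x)) &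
      mostly_slope t l v g a b].

(** [f] is kept on a margin of width [r] at each end, and a staircase in between is so fine that its
    error is at most [d * r], hence at most [d] times the distance to either end. *)
Lemma refines_affine t d l q k s f a b : 0 < d -> 0 < l -> 0 < q < 1 -> a < b ->
  (forall x, a <= x <= b -> f x = k + s * x) ->
  exists g, refines t d l (q * (b - a)) f g a b.
Proof.
move=> d0 l0 /andP[q0 q1] ab fE.
have [sg sg1 sgst] : exists2 sg : R, `|sg| = 1 & 0 <= sg * (s - t).
  have [ts|st] := leP t s; first by exists 1; rewrite ?normr1// mul1r subr_ge0.
  by exists (-1); rewrite ?normrN1// mulN1r oppr_ge0 subr_le0 ltW.
pose r := q / 4 * (b - a); have r0 : 0 < r by rewrite mulr_gt0 ?subr_gt0//; lra.
pose u := a + r; pose v := b - r.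
have r4 : r < (b - a) / 4 by rewrite /r; nra.
have [au uv vb] : [/\ a < u, u < v & v < b] by rewrite /u /v; split; lra.
have st0 : 0 <= `|s - t| + 1 by rewrite addr_ge0.
(* The summand [1] lets a single [n] bound both the error by [d * r] and the step length by [l]. *)
have [n nE] := @exists_div_exp2_le ((`|s - t| + 1) * (v - u)) (Num.min (d * r) l)
  ltac:(by rewrite mulr_ge0// subr_ge0 ltW)
  ltac:(by rewrite lt_min l0 mulr_gt0).
have vun : 0 <= (v - u) / 2 ^+ n by rewrite divr_ge0 ?exprn_ge0// subr_ge0 ltW.
move: nE; rewrite le_min -mulrA mulrDl mul1r => /andP[ndr nl].
have q4 : 0 < q / 4 < 1 by apply/andP; split; lra.
have [h [pah [hu hv] hb msh smh]] := @staircase sg t k s (q / 4) n u v sgst q4 uv.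
pose g := glue u f (glue v h f).
have fu : f u = k + s * u by apply: fE; apply/andP; split; lra.
have fv : f v = k + s * v by apply: fE; apply/andP; split; lra.
have gu : glue v h f u = h u by rewrite -glue_l ?ltW.
have E1 x : a <= x <= u -> f x = g x by move=> /andP[_ xu]; exact: glue_l.
have E2 x : u <= x <= v -> h x = g x.
  move=> /andP[ux xv]; rewrite /g -glue_r//; last by rewrite gu fu hu.
  exact: glue_l.
have E3 x : v <= x <= b -> f x = g x.
  move=> /andP[vx xb]; rewrite /g -glue_r//; last lra.
    by rewrite -glue_r// fv hv.
  by rewrite gu fu hu.
have auv : a <= u <= v by rewrite !ltW.
have avb : a <= v <= b by apply/andP; split; lra.
have smf x y : a <= x -> x <= y -> y <= b -> sheared_monotone sg t f x y.
  move=> ax xy yb z w xz zw wy; rewrite !fE; [|apply/andP; split; lra..].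
  have -> : sg * (k + s * w - (k + s * z) - t * (w - z)) = sg * (s - t) * (w - z).
    by ring.
  by rewrite mulr_ge0// subr_ge0.
have smg : sheared_monotone sg t g a b.
  apply: (sheared_monotone_cat avb); first apply: (sheared_monotone_cat auv).
  - by apply: eq_sheared_monotone E1 _; apply: smf; lra.
  - exact: eq_sheared_monotone E2 smh.
  - by apply: eq_sheared_monotone E3 _; apply: smf; lra.
exists g; split.
- apply: (@Concat_pieces _ v); first (apply/andP; split; lra).
    apply: (@Concat_pieces _ u); first by rewrite au.
      apply: eq_piecewise_affine E1 _; apply: (@Affine_piece _ _ _ k s) => x.
      by move=> /andP[ax xu]; apply: fE; apply/andP; split; lra.
    exact: eq_piecewise_affine E2 pah.
  apply: eq_piecewise_affine E3 _; apply: (@Affine_piece _ _ _ k s) => x.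
  by move=> /andP[vx xb]; apply: fE; apply/andP; split; lra.
- move=> x /andP[ax xb].
  have [xu|/ltW ux] := leP x u.
    rewrite -E1 ?ax// subrr normr0; split; apply: mulr_ge0; lra.
  have [xv|/ltW vx] := leP x v.
    rewrite -E2 ?ux// fE ?ax//.
    have /hb hx : u <= x <= v by rewrite ux.
    have {}hx : `|h x - (k + s * x)| <= d * r by lra.
    by split; apply: le_trans hx _; rewrite ler_pM2l//; rewrite /u /v in ux xv *; lra.
  rewrite -E3 ?vx// subrr normr0; split; apply: mulr_ge0; lra.
- move=> x z ax xz zb; left; exists sg => // y w xy yw wz.
  by apply: smg; lra.
(* The two margins and the steep parts have total measure at most [3 * q / 4 * (b - a)]. *)
- have m1 := mostly_slopeW E1 (lexx l) (lexx _) (mostly_slope_trivial t l f (ltW au)).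
  have m2 := mostly_slopeW E2 (_ : _ <= l) (lexx _) msh.
  have m3 := mostly_slopeW E3 (lexx l) (lexx _) (mostly_slope_trivial t l f (ltW vb)).
  have {}m2 := m2 ltac:(have := normr_ge0 (s - t); nra).
  have := mostly_slope_cat avb (mostly_slope_cat auv m1 m2) m3.
  by apply: mostly_slopeW => //; rewrite /v /u /r; nra.
Qed.

Lemma refines_exists t d l q f a b : 0 < d -> 0 < l -> 0 < q < 1 -> a < b ->
  piecewise_affine f a b -> exists g, refines t d l (q * (b - a)) f g a b.
Proof.
move=> d0 l0 q01 + paf; elim: paf => {a b} [a b k s fE|m a b amb _ IH1 _ IH2] ab.
  exact: refines_affine fE.
have /andP[am mb] := amb.
have amb' : a <= m <= b by rewrite !ltW.
have [g1 [pa1 b1 w1 ms1]] := IH1 am.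
have [g2 [pa2 b2 w2 ms2]] := IH2 mb.
have g1m : g1 m = f m.
  have [|_] := b1 m; first by rewrite lexx ltW.
  by rewrite subrr mulr0 normr_le0 subr_eq0 => /eqP.
have g2m : g2 m = f m.
  have [|+ _] := b2 m; first by rewrite lexx ltW.
  by rewrite subrr mulr0 normr_le0 subr_eq0 => /eqP.
pose g := glue m g1 g2.
have E1 x : a <= x <= m -> g1 x = g x by move=> /andP[_ ?]; exact: glue_l.
have E2 x : m <= x <= b -> g2 x = g x.
  by move=> /andP[? _]; apply: glue_r; rewrite ?g1m ?g2m.
exists g; split.
- apply: (@Concat_pieces _ m) => //.
    exact: eq_piecewise_affine E1 pa1.
  exact: eq_piecewise_affine E2 pa2.
- move=> x /andP[ax xb]; have [xm|/ltW mx] := leP x m.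
    have xam : a <= x <= m by rewrite ax.
    rewrite -E1//; have [h1 h2] := b1 x xam; split=> //.
    by apply: le_trans h2 _; rewrite ler_pM2l//; lra.
  have xmb : m <= x <= b by rewrite mx.
  rewrite -E2//; have [h1 h2] := b2 x xmb; split=> //.
  by apply: le_trans h1 _; rewrite ler_pM2l//; lra.
- move=> x z ax xz zb; have [zm|/ltW mz] := leP z m.
    have xE y : x <= y <= z -> g1 y = g y.
      by move=> /andP[xy yz]; apply: E1; apply/andP; split; lra.
    have [[sg sg1 sm]|h] := w1 x z ax xz zm.
      by left; exists sg => //; exact: eq_sheared_monotone xE sm.
    by right=> y xyz; rewrite -xE// h.
  have [mx|/ltW xm] := leP m x.
    have xE y : x <= y <= z -> g2 y = g y.
      by move=> /andP[xy yz]; apply: E2; apply/andP; split; lra.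
    have [[sg sg1 sm]|h] := w2 x z mx xz zb.
      by left; exists sg => //; exact: eq_sheared_monotone xE sm.
    by right=> y xyz; rewrite -xE// h.
  (* Here [m] lies between [x] and [z]: the error at [y] is at most [d] times the distance from [y]
     to [m], which is at most [z - x]. *)
  right=> y /andP[xy yz]; have [ym|/ltW my] := leP y m.
    have yam : a <= y <= m by apply/andP; split; lra.
    rewrite -E1//; have [_ h] := b1 y yam; apply: le_trans h _.
    by rewrite ler_pM2l//; lra.
  have ymb : m <= y <= b by apply/andP; split; lra.
  rewrite -E2//; have [h _] := b2 y ymb; apply: le_trans h _.
  by rewrite ler_pM2l//; lra.
- have -> : q * (b - a) = q * (m - a) + q * (b - m) by ring.
  apply: (mostly_slope_cat amb').
    exact: mostly_slopeW E1 (lexx _) (lexx _) ms1.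
  exact: mostly_slopeW E2 (lexx _) (lexx _) ms2.
Qed.

(** * Monotonicity constants of graphs *)

Definition graph_dist f x y := eucl_dist (x, f x) (y, f y).

(** This is the triangle inequality in the plane for a vertical second vector. *)
Lemma sqrt_sqrD_le (u v w : R) :
  Num.sqrt (u ^+ 2 + (v + w) ^+ 2) <= Num.sqrt (u ^+ 2 + v ^+ 2) + `|w|.
Proof.
have uv0 : 0 <= u ^+ 2 + v ^+ 2 by rewrite addr_ge0 ?sqr_ge0.
rewrite -ler_sqr ?nnegrE ?sqrtr_ge0 ?addr_ge0 ?sqrtr_ge0//.
rewrite sqr_sqrtr ?addr_ge0 ?sqr_ge0// [leRHS]sqrrD sqr_sqrtr// real_normK ?num_real//.
have vS : `|v| <= Num.sqrt (u ^+ 2 + v ^+ 2) by rewrite -sqrtr_sqr ler_wsqrtr// lerDr sqr_ge0.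
have : v * w <= `|v| * `|w| by rewrite -normrM ler_norm.
have : `|v| * `|w| <= Num.sqrt (u ^+ 2 + v ^+ 2) * `|w| by rewrite ler_wpM2r.
lra.
Qed.

Lemma graph_dist_perturb f g d x y : `|g x - f x| <= d -> `|g y - f y| <= d ->
  graph_dist g x y <= graph_dist f x y + 2 * d.
Proof.
move=> gx gy; rewrite /graph_dist /eucl_dist/=.
have -> : g x - g y = (f x - f y) + ((g x - f x) - (g y - f y)) by ring.
apply: le_trans (sqrt_sqrD_le _ _ _) _; rewrite lerD2l.
by apply: le_trans (ler_normB _ _) _; lra.
Qed.

Lemma graph_dist_ge f x y : y - x <= graph_dist f x y.
Proof.
apply: le_trans (ler_norm _) _; rewrite distrC -sqrtr_sqr ler_wsqrtr//=.
by rewrite lerDl sqr_ge0.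
Qed.

(** This is symmetric [c]-monotonicity of the graph over [[0, 1]] for the order by abscissa. *)
Definition graph_monotone c f := forall x y z, 0 <= x -> x <= y -> y <= z -> z <= 1 ->
  graph_dist f x y <= c * graph_dist f x z /\ graph_dist f y z <= c * graph_dist f x z.

Lemma sqrt_sqr_shear_le (t u v : R) :
  Num.sqrt (u ^+ 2 + (v + t * u) ^+ 2) <= (1 + `|t|) * Num.sqrt (u ^+ 2 + v ^+ 2).
Proof.
have uv0 : 0 <= u ^+ 2 + v ^+ 2 by rewrite addr_ge0 ?sqr_ge0.
apply: le_trans (sqrt_sqrD_le _ _ _) _; rewrite mulrDl mul1r lerD2l normrM.
by rewrite ler_wpM2l// -sqrtr_sqr ler_wsqrtr// lerDl sqr_ge0.
Qed.

(* A monotone graph is [1]-monotone, and the shear [(u, v) |-> (u, v - t u)]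
   and its inverse have norm at most [1 + |t|]. *)
Lemma sheared_monotone_graph_dist sg t e g x y z : `|sg| = 1 -> `|t| <= e ->
  sheared_monotone sg t g x z -> x <= y -> y <= z ->
  graph_dist g x y <= (1 + e) ^+ 2 * graph_dist g x z /\
  graph_dist g y z <= (1 + e) ^+ 2 * graph_dist g x z.
Proof.
move=> sg1 te sm xy yz.
have sg2 : sg ^+ 2 = 1 by rewrite -[LHS]ger0_norm ?sqr_ge0// normrX sg1 expr1n.
pose A p q := sg * (g q - g p - t * (q - p)).
have upper p q : graph_dist g p q <= (1 + e) * Num.sqrt ((q - p) ^+ 2 + (A p q) ^+ 2).
  have -> : graph_dist g p q
      = Num.sqrt ((q - p) ^+ 2 + ((g q - g p - t * (q - p)) + t * (q - p)) ^+ 2).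
    by rewrite /graph_dist /eucl_dist/=; congr Num.sqrt; ring.
  apply: le_trans (sqrt_sqr_shear_le _ _ _) _.
  by rewrite /A exprMn sg2 mul1r ler_wpM2r ?sqrtr_ge0//; lra.
have lower p q : Num.sqrt ((q - p) ^+ 2 + (A p q) ^+ 2) <= (1 + e) * graph_dist g p q.
  rewrite /A exprMn sg2 mul1r -mulNr; apply: le_trans (sqrt_sqr_shear_le _ _ _) _.
  have -> : Num.sqrt ((q - p) ^+ 2 + (g q - g p) ^+ 2) = graph_dist g p q.
    by rewrite /graph_dist /eucl_dist/=; congr Num.sqrt; ring.
  by rewrite normrN ler_wpM2r ?sqrtr_ge0//; lra.
have Axy : 0 <= A x y by apply: sm.
have Ayz : 0 <= A y z by apply: sm.
have AD : A x z = A x y + A y z by rewrite /A; ring.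
(* After the shear both coordinates of the shorter increment are dominated by those of the longer
   one; each change of coordinates costs a factor [1 + e]. *)
have key p q : 0 <= q - p <= z - x -> 0 <= A p q <= A x z ->
    graph_dist g p q <= (1 + e) ^+ 2 * graph_dist g x z.
  move=> /andP[pq0 pq] /andP[A0 Apq]; apply: le_trans (upper p q) _.
  have e0 : 0 <= 1 + e by have := normr_ge0 t; lra.
  rewrite expr2 -mulrA ler_wpM2l//; apply: le_trans (lower x z).
  rewrite ler_wsqrtr// lerD// ler_sqr// nnegrE//; lra.
by split; apply: key; rewrite ?AD; apply/andP; split; lra.
Qed.

(** The constant stays strictly below [c], which leaves slack for the next refinement. Within a
    piece the constant is [(1 + eps) ^+ 2], whatever [f] is; across a break point the perturbation
    uses up half of the slack [c - c1]. *)
Lemma refinement_step c eps t c1 q e f : 0 < eps -> `|t| <= eps ->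
  (1 + eps) ^+ 2 <= c1 < c -> 0 < q < 1 -> 0 < e ->
  piecewise_affine f 0 1 -> graph_monotone c1 f ->
  exists g, [/\ piecewise_affine g 0 1,
    forall x, 0 <= x <= 1 -> `|g x - f x| <= e,
    mostly_slope t q q g 0 1 &
    exists2 c2, (1 + eps) ^+ 2 <= c2 < c & graph_monotone c2 g].
Proof.
move=> eps0 teps /andP[c1l c1c] q01 e0 paf mf.
have c11 : 1 <= c1 by apply: le_trans c1l; nra.
(* Perturbing the three distances costs [2 * d * (c1 + 1) * (z - x)] in all, and [z - x] is at most
   the distance between the graph points over [x] and [z]. *)
pose d := Num.min e ((c - c1) / (4 * (c1 + 1))).
have d0 : 0 < d by rewrite lt_min e0 divr_gt0//; lra.
have dc : 2 * d * (c1 + 1) <= (c - c1) / 2.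
  have : d <= (c - c1) / (4 * (c1 + 1)) by rewrite ge_min lexx orbT.
  rewrite ler_pdivlMr; last lra.
  by lra.
have q0 : 0 < q by case/andP: q01.
have [g [pag bg wg]] := refines_exists t d0 q0 q01 ltr01 paf.
rewrite subr0 mulr1 => msg; exists g; split => //.
  move=> x x01; have [+ _] := bg x x01; rewrite subr0 => /le_trans; apply.
  have : d <= e by rewrite ge_min lexx.
  by case/andP: x01; nra.
exists ((c + c1) / 2); first by apply/andP; split; lra.
move=> x y z x0 xy yz z1; have xz := le_trans xy yz.
have gxz : 0 <= graph_dist g x z by exact: sqrtr_ge0.
have [[sg sg1 sm]|h] := wg x z x0 xz z1.
  have [h1 h2] := sheared_monotone_graph_dist sg1 teps sm xy yz.
  by split; [apply: le_trans h1 _|apply: le_trans h2 _]; rewrite ler_wpM2r//; lra.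
have [h1 h2] := mf _ _ _ x0 xy yz z1.
have hx := h x; rewrite lexx xz in hx; have {}hx := hx isT.
have hz := h z; rewrite lexx xz in hz; have {}hz := hz isT.
have hy := h y; rewrite xy yz in hy; have {}hy := hy isT.
have pxy := graph_dist_perturb hx hy; have pyz := graph_dist_perturb hy hz.
have pxz : graph_dist f x z <= graph_dist g x z + 2 * (d * (z - x)).
  by apply: graph_dist_perturb; rewrite distrC.
have zx := graph_dist_ge g x z.
have key D D' : D' <= c1 * graph_dist f x z -> D <= D' + 2 * (d * (z - x)) ->
    D <= (c + c1) / 2 * graph_dist g x z.
  move=> DD' DD.
  have h3 : c1 * graph_dist f x z <= c1 * (graph_dist g x z + 2 * (d * (z - x))).
    by rewrite ler_wpM2l//; lra.
  have h4 : 2 * d * (c1 + 1) * (z - x) <= (c - c1) / 2 * graph_dist g x z.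
    by apply: ler_pM => //; [nra|lra].
  by lra.
by split; [apply: key h1 pxy|apply: key h2 pyz].
Qed.

(** * The sequence of stages *)

Definition target_slope (eps : R) (n : nat) : R := if odd n then eps else 0.

(** The tolerance bounds both an exceptional measure and a distance [|y - x|]. The series has sum
    [1], and the exponent [n.+1] keeps every term below [1]. *)
Definition tol n : R := 1 / (2 ^ n.+1)%:R.

Lemma tol01 n : 0 < tol n < 1.
Proof.
rewrite /tol div1r invr_gt0 invf_lt1 ?ltr0n ?expn_gt0//=.
by rewrite ltr1n -{1}(expn0 2) ltn_exp2l.
Qed.

(* A stage is a pair of a function and of a bound for the next modification of it. *)
Definition stage_inv c eps (s : (R -> R) * R) :=
  [/\ piecewise_affine s.1 0 1, 0 < s.2 &
      exists2 c1, (1 + eps) ^+ 2 <= c1 < c & graph_monotone c1 s.1].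

(** The limit will differ from [s'.1] by at most [2 * s'.2] at [x] and at [y]; the factor [16] makes
    the resulting change of the difference quotient at most [eps / 4]. *)
Definition stage_step eps n (s s' : (R -> R) * R) :=
  [/\ forall x, 0 <= x <= 1 -> `|s'.1 x - s.1 x| <= s.2, s'.2 <= s.2 / 2 &
    exists B : set R, [/\ measurable B, (lebesgue_measure B <= (tol n)%:E)%E &
      forall x, 0 <= x <= 1 -> ~ B x ->
        exists y, [/\ 0 <= y <= 1, 16 * s'.2 <= eps * `|y - x|,
          `|y - x| <= tol n & s'.1 y - s'.1 x = target_slope eps n * (y - x)]]].

Lemma stages_exist c eps : 0 < eps -> (1 + eps) ^+ 2 < c ->
  exists s : nat -> (R -> R) * R,
    forall n, stage_inv c eps (s n) /\ stage_step eps n (s n) (s n.+1).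
Proof.
move=> eps0 epsc; pose S := {s | stage_inv c eps s}.
have step (p : nat * S) : exists s' : S, stage_step eps p.1 (sval p.2) (sval s').
  case: p => n [[f e] [/= paf e0 [c1 c1c mf]]].
  have teps : `|target_slope eps n| <= eps.
    by rewrite /target_slope; case: ifP; rewrite ?normr0 ?(ltW eps0)// gtr0_norm.
  have [g [pag bg [e1 e10 [B [mB Bq HB]]] [c2 c2c mg]]] :=
    refinement_step eps0 teps c1c (tol01 n) e0 paf mf.
  (* The first term makes the bounds halve; the second uses the lower bound [e1] on [|y - x|]. *)
  pose e' := Num.min (e / 2) (eps * e1 / 16).
  have e'0 : 0 < e' by rewrite lt_min !divr_gt0// mulr_gt0.
  have inv' : stage_inv c eps (g, e') by split => //=; exists c2.
  exists (exist _ _ inv'); split => //=; first by rewrite ge_min lexx.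
  exists B; split => // x x01 nB; have [y [y01 /andP[ey yq] yE]] := HB x x01 nB.
  exists y; split => //.
  have : e' <= eps * e1 / 16 by rewrite ge_min lexx orbT.
  have : eps * e1 <= eps * `|y - x| by rewrite ler_pM2l.
  by lra.
have [F HF] := choice step.
have inv0 : stage_inv c eps (fun=> 0, 1).
  split => //=; first by apply: (@Affine_piece _ _ _ 0 0) => x _; rewrite mul0r addr0.
  exists ((1 + eps) ^+ 2); first by rewrite lexx.
  move=> x y z x0 xy yz z1.
  have h : sheared_monotone 1 0 (fun=> 0) x z.
    by move=> ? ? ? ? ?; rewrite subr0 mul0r subr0 mulr0.
  by apply: (sheared_monotone_graph_dist _ _ h); rewrite ?normr1 ?normr0 ?(ltW eps0).
(* The choice function also receives the index, since the target slope depends on its parity. *)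
pose s := fix s n : S := if n is m.+1 then F (m, s m) else exist _ _ inv0.
exists (fun n => sval (s n)) => n; split; first exact: (svalP (s n)).
exact: HF (n, s n).
Qed.

(** * Passage to the limit *)

(** The intervals of centre [F n x] and radius [2 * e n] are nested; the supremum of their left ends
    lies in all of them. *)
Lemma summable_limit (F : nat -> R -> R) (e : nat -> R) (A : set R) :
  (forall n, e n.+1 <= e n / 2) ->
  (forall n x, A x -> `|F n.+1 x - F n x| <= e n) ->
  exists f, forall n x, A x -> `|f x - F n x| <= 2 * e n.
Proof.
move=> e2 He; pose E x := range (fun n => F n x - 2 * e n).
exists (fun x => sup (E x)) => n x Ax.
have lo p (k : nat) : F p x - 2 * e p <= F (p + k)%N x - 2 * e (p + k)%N.
  elim: k => [|k IH]; first by rewrite addn0.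
  rewrite addnS; apply: le_trans IH _.
  have := He (p + k)%N x Ax; rewrite ler_norml => /andP[h _].
  by have := e2 (p + k)%N; lra.
have hi p (k : nat) : F (p + k)%N x + 2 * e (p + k)%N <= F p x + 2 * e p.
  elim: k => [|k IH]; first by rewrite addn0.
  rewrite addnS; apply: le_trans _ IH.
  have := He (p + k)%N x Ax; rewrite ler_norml => /andP[_ h].
  by have := e2 (p + k)%N; lra.
have e0 p : 0 <= e p by apply: le_trans (He p x Ax).
(* Each left end is compared with each right end through the interval of index [p + k]. *)
have ubE p : ubound (E x) (F p x + 2 * e p).
  move=> _ [k _ <-]; have := lo k p; have := hi p k; rewrite (addnC k p).
  by have := e0 (p + k)%N; lra.
have l1 : F n x - 2 * e n <= sup (E x).
  by apply: ub_le_sup; [exists (F n x + 2 * e n)|exists n].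
have l2 : sup (E x) <= F n x + 2 * e n.
  by apply: ge_sup => //; exists (F n x - 2 * e n); exists n.
by rewrite ler_norml; apply/andP; split; lra.
Qed.

(** Arbitrarily near [x] there are quotients within [eps / 4] of [0] and others within [eps / 4] of
    [eps]. They are at least [eps / 2] apart, which excludes a finite limit; the former stay
    bounded, which excludes an infinite one. *)
Lemma no_ext_derivative f eps x : 0 < eps ->
  (forall d t, 0 < d -> t = 0 \/ t = eps -> exists y, [/\ 0 <= y <= 1, y != x,
    `|y - x| < d & `|(f y - f x) / (y - x) - t| <= eps / 4]) ->
  ~ has_ext_derivative f x.
Proof.
move=> eps0 H [l].
have near_dq (P : R -> Prop) : (\forall y \near within unit_interval (x^'), P y) ->
    exists2 d, 0 < d & forall y, 0 <= y <= 1 -> y != x -> `|y - x| < d -> P y.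
  move=> /nbhs_ballP[d /= d0 hd]; exists d => // y y01 yx yd.
  by apply: hd => //; rewrite /ball/= distrC.
case: l => [r||].
- move=> /fine_cvgP[_ /cvgrPdist_lt /(_ (eps / 4))] /(_ ltac:(lra)) /near_dq[d d0 hd].
  have [y [y01 yx yd]] := H d 0 d0 (or_introl erefl).
  have [z [z01 zx zd]] := H d eps d0 (or_intror erefl).
  have := hd y y01 yx yd; have := hd z z01 zx zd => /=.
  rewrite !ltr_norml !ler_norml.
  by move=> /andP[? ?] /andP[? ?] /andP[? ?] /andP[? ?]; lra.
- move=> /cvgeyPgt /(_ eps) /near_dq[d d0 hd].
  have [y [y01 yx yd]] := H d 0 d0 (or_introl erefl).
  have := hd y y01 yx yd; rewrite lte_fin !ler_norml.
  by move=> ? /andP[? ?]; lra.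
- move=> /cvgeNyPlt /(_ (- eps)) /near_dq[d d0 hd].
  have [y [y01 yx yd]] := H d 0 d0 (or_introl erefl).
  have := hd y y01 yx yd; rewrite lte_fin !ler_norml.
  by move=> ? /andP[? ?]; lra.
Qed.

Lemma graph_monotone_sym_c_monotone c f : graph_monotone c f ->
  sym_c_monotone c (graph01 f).
Proof.
move=> mf; exists (fun p q => p.1 < q.1); split.
  split=> [x _|x y z _ _ _|[x fx] [y fy] [_ /= xE] [_ /= yE] xy].
  - by rewrite ltxx.
  - exact: lt_trans.
  - have /lt_total/orP : x != y by apply/eqP => xy'; apply: xy; rewrite xE yE xy'.
    by [].
move=> [x fx] [y fy] [z fz] [/andP[/= x0 _] /= ->] [_ /= ->] [/andP[/= _ z1] /= ->].
move=> /= xy yz; rewrite ge_max; apply/andP.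
exact: mf x0 (ltW xy) (ltW yz) z1.
Qed.

Lemma piecewise_affine_limit_continuous f :
  (forall e, 0 < e -> exists2 g, piecewise_affine g 0 1 &
    forall x, 0 <= x <= 1 -> `|f x - g x| <= e) ->
  {within unit_interval, continuous f}.
Proof.
move=> H; apply/subspace_continuousP => x x01.
apply/cvgrPdist_lt => e e0.
have [|g /piecewise_affine_lipschitz[k k0 gk] fg] := H (e / 4); first lra.
have gk' y z : 0 <= y <= 1 -> 0 <= z <= 1 -> `|g y - g z| <= k * `|y - z|.
  wlog zy : y z / z <= y => [W|].
    by have [/W//|/ltW yz y01 z01] := leP z y; rewrite distrC (distrC y) W.
  move=> /andP[y0 y1] /andP[z0 z1]; rewrite (@ger0_norm _ (y - z)) ?subr_ge0//.
  by rewrite gk// z0.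
apply/nbhs_ballP; exists (e / (4 * k)); first by rewrite /= divr_gt0// mulr_gt0.
move=> y; rewrite /ball/= ltr_pdivlMr ?mulr_gt0// => xy y01.
have := fg x x01; have := fg y y01; have := gk' x y x01 y01.
rewrite (_ : f x - f y = (f x - g x) + (g x - g y) - (f y - g y)); last by ring.
move=> h1 h2 h3; apply: le_lt_trans (ler_normB _ _) _.
by have := ler_normD (f x - g x) (g x - g y); lra.
Qed.

Lemma graph_monotone_limit c f : 0 <= c ->
  (forall e, 0 < e -> exists2 g, graph_monotone c g &
    forall x, 0 <= x <= 1 -> `|f x - g x| <= e) ->
  graph_monotone c f.
Proof.
move=> c0 H x y z x0 xy yz z1.
have x01 : 0 <= x <= 1 by apply/andP; split; lra.
have y01 : 0 <= y <= 1 by apply/andP; split; lra.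
have z01 : 0 <= z <= 1 by apply/andP; split; lra.
split; apply/ler_addgt0Pr => e e0.
(* The distance on the left and [c] times that on the right change by at most [2 * (1 + c)] times
   this error, that is by [e]. *)
all: have [|g mg fg] := H (e / (2 * (1 + c))); first by rewrite divr_gt0//; lra.
all: have [h1 h2] := mg _ _ _ x0 xy yz z1.
all: have := graph_dist_perturb (fg x x01) (fg y y01).
all: have := graph_dist_perturb (fg y y01) (fg z z01).
all: have : graph_dist g x z <= graph_dist f x z + 2 * (e / (2 * (1 + c)))
  by apply: graph_dist_perturb; rewrite distrC; apply: fg.
all: move=> /(ler_wpM2l c0).
all: have : 2 * (e / (2 * (1 + c))) * (1 + c) = e by field; apply/lt0r_neq0; lra.
all: set q := e / _; lra.
Qed.

Lemma graph_monotoneW c c' f : c <= c' -> graph_monotone c f -> graph_monotone c' f.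
Proof.
move=> cc mf x y z x0 xy yz z1; have [h1 h2] := mf _ _ _ x0 xy yz z1.
have := ler_wpM2r (sqrtr_ge0 _ : 0 <= graph_dist f x z) cc.
by split; lra.
Qed.

Lemma halving_le (e : nat -> R) n : (forall i : nat, e i.+1 <= e i / 2) ->
  e n <= e 0%N / 2 ^+ n.
Proof.
move=> e2; elim: n => [|n IH]; first by rewrite divr1.
apply: le_trans (e2 n) _; by rewrite exprSr invfM mulrA ler_pM2r.
Qed.

(** * Non-differentiability almost everywhere *)

(** Prescribing the parity of [n] selects one of the two target slopes. *)
Lemma tol_lt d (N : nat) (b : bool) : 0 < d -> exists n, [/\ (N <= n)%N, odd n = b & tol n < d].
Proof.
move=> d0; have [M hM] := @exists_div_exp2_le 1 d ler01 d0.
exists ((N + M).*2 + b)%N; split; first lia.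
  by rewrite oddD odd_double; case: b.
apply: lt_le_trans hM; rewrite /tol ltr_pM2l// natrX ltf_pV2 ?posrE ?exprn_gt0//.
by rewrite ltr_eXn2l ?ltr1n//; lia.
Qed.

Lemma ext_diff_points_negligible eps f (s : nat -> (R -> R) * R) : 0 < eps ->
  (forall n, 0 < (s n).2) -> (forall n, stage_step eps n (s n) (s n.+1)) ->
  (forall n x, unit_interval x -> `|f x - (s n).1 x| <= 2 * (s n).2) ->
  lebesgue_measure.-negligible (ext_diff_points f).
Proof.
move=> eps0 s0 step fs.
have /choice[B HB] : forall n, exists B : set R,
    [/\ measurable B, (lebesgue_measure B <= (tol n)%:E)%E &
      forall x, 0 <= x <= 1 -> ~ B x ->
        exists y, [/\ 0 <= y <= 1, 16 * (s n.+1).2 <= eps * `|y - x|,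
          `|y - x| <= tol n &
          (s n.+1).1 y - (s n.+1).1 x = target_slope eps n * (y - x)]].
  by move=> n; have [_ _] := step n.
have mB n : measurable (B n) by have [] := HB n.
(* Borel-Cantelli: the measures of the [B n] have sum at most [1], and a point outside the upper
   limit lies in no [B n] from some index on. *)
exists (lim_sup_set B); split.
- apply: bigcapT_measurable => n; apply: bigcup_measurable => i _; exact: mB.
- apply: lim_sup_set_cvg0 => //.
  apply: (@le_lt_trans _ _ 1%:E); last exact: ltry.
  apply: le_trans (epsilon_trick0 xpredT ler01).
  by apply: lee_nneseries => n; [move=> _ _; exact: measure_ge0|have [] := HB n].
- move=> x [x01 dfx]; apply: contrapT => nx.
  have [N HN] : exists N, forall n, (N <= n)%N -> ~ B n x.
    move/existsNP: nx => [N /not_implyP[_ nN]]; exists N => n Nn Bx.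
    by apply: nN; exists n.
  apply: (no_ext_derivative eps0 _ dfx) => d t d0 tE.
  have [n [Nn oddn nd]] := tol_lt N (t == eps) d0.
  have nE : target_slope eps n = t.
    rewrite /target_slope oddn; case: eqP => // teps.
    by case: tE.
  have [_ _ /(_ x x01 (HN n Nn))[y [y01 ey ytol yE]]] := HB n.
  (* The positive error bound of stage [n.+1] forces [y] to differ from [x]. *)
  have yx0 : 0 < `|y - x|.
    by rewrite -(pmulr_rgt0 _ eps0); have := s0 n.+1; lra.
  have yx : y - x != 0 by rewrite -normr_gt0.
  exists y; split => //; first by rewrite -subr_eq0.
    exact: le_lt_trans ytol nd.
  have -> : (f y - f x) / (y - x) - t = (f y - f x - t * (y - x)) / (y - x) by field.
  rewrite normrM normfV ler_pdivrMr//.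
  have := fs n.+1 y y01; have := fs n.+1 x x01; rewrite -nE -yE => h1 h2.
  rewrite (_ : f y - f x - _ = (f y - (s n.+1).1 y) - (f x - (s n.+1).1 x)); last by ring.
  by apply: le_trans (ler_normB _ _) _; lra.
Qed.

End OscillatingGraphs.

Theorem theorem5p1 (R : realType) (c : R) (hc : 1 < c) :
  exists f : R -> R,
    {within unit_interval, continuous f} /\
    sym_c_monotone c (graph01 f) /\
    (@lebesgue_measure R).-negligible (ext_diff_points f).
Proof.
(* As [eps <= 1], [(1 + eps) ^+ 2 <= 1 + 3 * eps], and [3 * eps < c - 1]. *)
pose eps : R := Num.min 1 ((c - 1) / 4).
have eps0 : 0 < eps by rewrite lt_min ltr01 divr_gt0//; lra.
have epsc : (1 + eps) ^+ 2 < c.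
  have : eps <= 1 by rewrite ge_min lexx.
  have : eps <= (c - 1) / 4 by rewrite ge_min lexx orbT.
  by nra.
have [s sP] := stages_exist eps0 epsc.
have step n : stage_step eps n (s n) (s n.+1) by have [] := sP n.
have s0 n : 0 < (s n).2 by have [[]] := sP n.
have halve n : (s n.+1).2 <= (s n).2 / 2 by have [] := step n.
have [f fs] : exists f, forall n x, unit_interval x -> `|f x - (s n).1 x| <= 2 * (s n).2.
  by apply: (summable_limit halve) => n; have [] := step n.
have approx e : 0 < e -> exists n, forall x, 0 <= x <= 1 -> `|f x - (s n).1 x| <= e.
  move=> e0; have [||n hn] := @exists_div_exp2_le R (s 0%N).2 (e / 2).
  - exact: ltW.
  - by lra.
  exists n => x x01; apply: le_trans (fs n x x01) _.
  by have := halving_le n halve => /=; lra.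
exists f; split; [|split].
- apply: piecewise_affine_limit_continuous => e /approx[n hn]; exists (s n).1 => //.
  by have [[]] := sP n.
- apply/graph_monotone_sym_c_monotone/graph_monotone_limit; first by lra.
  move=> e /approx[n hn]; exists (s n).1 => //.
  have [[_ _ [c1 /andP[_ c1c] mf]] _] := sP n.
  exact: graph_monotoneW (ltW c1c) mf.
- exact: ext_diff_points_negligible eps0 s0 step fs.
Qed.
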